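(* Let $d\ge 1$, $N\ge 2$ and $M\ge 3$ be integers, let $\mathcal N=\{0,\dots,N-1\}^d$ and $h=2\pi/N$. Let $(f_n)_{n\in\mathcal N}$ be (complex) grid data, extended $N$-periodically in each index to $\mathbb Z^d$, with discrete Fourier coefficients $$c_k=\sum_{n\in\mathcal N} f_n\,e^{-\frac{2\pi i}{N}k\cdot n},\qquad k\in\mathcal N .$$ Assume that for some constant $C>0$, $$|c_k|\le N^d\Bigl(\frac{2\pi}{N}\Bigr)^{Md} C\prod_{j=1}^d\bigl|e^{-2\pi i k_j/N}-1\bigr|^{-M}$$ for all $k=(k_1,\dots,k_d)\in\mathcal N$ with $k_j\neq 0$ for every $j=1,\dots,d$ (when some $k_j=0$ the right-hand side is read as $+\infty$, so no condition is imposed). Then the mixed divided differences of order $(M-2,\dots,M-2)$ satisfy $$\|\delta_1^{M-2}\cdots\delta_d^{M-2}f\|_\infty\le\Bigl(\frac{\pi^2}{3}\Bigr)^d\Bigl(1-\frac1{N^2}\Bigr)^d C .$$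
   Context: The grid is $\{2\pi n/N : n\in\mathcal N\}\subset[0,2\pi)^d$ with mesh size $h=2\pi/N$, and $f_n$ is the value at the grid point $2\pi n/N$. The inverse transform is $f_n=N^{-d}\sum_{k\in\mathcal N}c_k e^{\frac{2\pi i}{N}k\cdot n}$. For a grid function $f$ (periodic in each index with period $N$), the forward difference in direction $j$ is $(\Delta_j f)_n=f_{n+\mathbf e_j}-f_n$, where $\mathbf e_j$ is the $j$-th standard unit vector. The divided difference of order $m$ in direction $j$ is $\delta_j^m=h^{-m}\Delta_j^m$ (the $m$-fold forward difference divided by $h^m$, without factorials). $\|\cdot\|_\infty$ is the maximum of the absolute value over grid points. *)

(* Defs.v *)
From HB Require Import structures.
From mathcomp Require Import all_boot all_order all_algebra.
From mathcomp Require Import complex.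
From mathcomp Require Import reals trigo.

Set Implicit Arguments.
Unset Strict Implicit.
Unset Printing Implicit Defensive.

Import Order.TTheory GRing.Theory Num.Theory.

Local Open Scope ring_scope.
Local Open Scope complex_scope.

(* The index set {0, ..., N-1}^d; the direction written j = 1, ..., d on paper
   is an element of 'I_d here. *)
Definition grid (d N : nat) := {ffun 'I_d -> 'I_N}.

Lemma absz_modz_lt (N : nat) (N_gt0 : (0 < N)%N) (z : int) :
  (`|(z %% N)%Z| < N)%N.
Proof.
have N0 : (N : int) != 0 by rewrite eqz_nat -lt0n.
by rewrite -ltz_nat gez0_abs ?modz_ge0 // ltz_pmod // ltz_nat.
Qed.

Definition residue (N : nat) (N_gt0 : (0 < N)%N) (z : int) : 'I_N :=
  Ordinal (absz_modz_lt N_gt0 z).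

Definition periodic_ext (T : Type) (d N : nat) (N_gt0 : (0 < N)%N)
    (f : grid d N -> T) : 'rV[int]_d -> T :=
  fun n => f [ffun j => residue N_gt0 (n 0 j)].

Definition grid_index (d N : nat) (n : grid d N) : 'rV[int]_d :=
  \row_j (n j : nat)%:Z.

Definition expi (R : realType) (t : R) : R[i] := cos t +i* sin t.

Definition mesh (R : realType) (N : nat) : R := 2 * pi / N%:R.

Definition dotn (d N : nat) (k n : grid d N) : nat := (\sum_(j < d) k j * n j)%N.

Definition dft (R : realType) (d N : nat) (f : grid d N -> R[i])
    (k : grid d N) : R[i] :=
  \sum_(n : grid d N) f n * expi (- (2 * pi / N%:R * (dotn k n)%:R)).

Definition fwd_diff (R : realType) (d : nat) (j : 'I_d)
    (g : 'rV[int]_d -> R[i]) : 'rV[int]_d -> R[i] :=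
  fun n => g (n + delta_mx 0 j) - g n.

Definition div_diff (R : realType) (d N m : nat) (j : 'I_d)
    (g : 'rV[int]_d -> R[i]) : 'rV[int]_d -> R[i] :=
  fun n => (mesh R N ^- m)%:C * iter m (fwd_diff j) g n.

Definition mixed_div_diff (R : realType) (d N m : nat)
    (g : 'rV[int]_d -> R[i]) : 'rV[int]_d -> R[i] :=
  foldr (div_diff N m) g (enum 'I_d).

(* The default 0 of the iterated maximum is harmless: moduli are nonnegative. *)
Definition grid_norm (R : realType) (d N : nat) (g : 'rV[int]_d -> R[i]) : R :=
  \big[Num.max/0]_(n : grid d N) Normc.normc (g (grid_index n)).

(* Main.v *)
(* Let w = exp(2 pi i / N). By Fourier inversion the periodic extension of f is
   the sum over k of N^-d c_k w^(k.n), and a difference in direction j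
   multiplies the k-th mode by w^k_j - 1. Since M - 2 > 0, the modes with some
   k_j = 0 drop out, and the decay hypothesis bounds each remaining one by
   C * prod_j h^2 |w^k_j - 1|^-2. The sum over k factors into d copies of
   h^2 * sum_(0 < k < N) |w^k - 1|^-2 = h^2 (N^2 - 1) / 12. *)
Require Import Defs.
From mathcomp Require Import all_boot all_order all_algebra.
From mathcomp Require Import complex.
From mathcomp Require Import reals trigo.
From mathcomp Require Import ring lra.

Import Order.TTheory GRing.Theory Num.Theory.

Local Open Scope ring_scope.
Local Open Scope complex_scope.

(** * Power sums of roots of unity *)

Lemma sum_prim_root_orthogonal (F : fieldType) (N : nat) (w : F)
    (w_prim : N.-primitive_root w) (n m : 'I_N) :
  \sum_(k < N) w ^+ (k * n) * w ^- (k * m) = (n == m)%:R * N%:R.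
Proof.
have w_neq0 : w != 0.
  by rewrite (prim_root_eq0 w_prim) -lt0n (prim_order_gt0 w_prim).
pose z := w ^+ n / w ^+ m.
rewrite (eq_bigr (fun k : 'I_N => z ^+ k)); last first.
  by move=> k _; rewrite /z expr_div_n -!exprM !(mulnC k).
have zN : z ^+ N = 1.
  by rewrite expr_div_n !(exprAC w _ N) (prim_expr_order w_prim) !expr1n divr1.
(* Either [z = 1] or the geometric sum vanishes; [z = 1] forces [n = m], since both exponents are
   below [N]. *)
have /esym/eqP := subrX1 z N; rewrite zN subrr mulf_eq0.
have [n_eq_m|n_neq_m] := eqVneq n m.
  rewrite mul1r => _; rewrite /z n_eq_m divff ?expf_neq0 //.
  by under eq_bigr do rewrite expr1n; rewrite sumr_const card_ord.
rewrite mul0r subr_eq0 => /orP[|/eqP //].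
rewrite /z -(inj_eq (mulIf (expf_neq0 m w_neq0))) divfK ?expf_neq0 // mul1r.
rewrite (eq_prim_root_expr w_prim) !modn_small // => /eqP/val_inj.
by move/eqP; rewrite (negbTE n_neq_m).
Qed.

(** Summation by parts: [n * z ^ n * (z - 1)] is the increment of [n * z ^ n] minus [z * z ^ n]. The
    increments telescope to [N] and the geometric sum vanishes. *)
Lemma sum_natr_expr (F : fieldType) (N : nat) (z : F) :
  z ^+ N = 1 -> z != 1 -> \sum_(n < N) n%:R * z ^+ n = N%:R / (z - 1).
Proof.
move=> zN z_neq1; have z1 : z - 1 != 0 by rewrite subr_eq0.
have geom : \sum_(n < N) z ^+ n = 0.
  by apply: (mulfI z1); rewrite -subrX1 zN subrr mulr0.
apply: (mulIf z1); rewrite divfK // mulr_suml.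
have -> : \sum_(n < N) n%:R * z ^+ n * (z - 1) =
    \sum_(0 <= n < N) (n.+1%:R * z ^+ n.+1 - n%:R * z ^+ n)
    - z * \sum_(n < N) z ^+ n.
  rewrite big_mkord mulr_sumr -sumrB; apply: eq_bigr => n _.
  by rewrite exprS -natr1; ring.
by rewrite telescope_sumr // geom zN mulr1 mul0r mulr0 !subr0.
Qed.

Lemma sum_natr (F : numFieldType) (N : nat) :
  \sum_(n < N) n%:R = N%:R * (N%:R - 1) / 2 :> F.
Proof.
elim: N => [|N IH]; first by rewrite big_ord0 !mul0r.
by rewrite big_ord_recr /= IH -natr1; field.
Qed.

Lemma sum_natr_sqr (F : numFieldType) (N : nat) :
  \sum_(n < N) n%:R ^+ 2 = N%:R * (N%:R - 1) * (2 * N%:R - 1) / 6 :> F.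
Proof.
elim: N => [|N IH]; first by rewrite big_ord0 !mul0r.
by rewrite big_ord_recr /= IH -natr1; field.
Qed.

Lemma norm_prim_root (F : numDomainType) (N : nat) (w : F) :
  N.-primitive_root w -> `|w| = 1.
Proof.
move=> w_prim; apply/eqP.
rewrite -(pexpr_eq1 (prim_order_gt0 w_prim)) //.
by rewrite -normrX (prim_expr_order w_prim) normr1.
Qed.

(* Parseval's identity for the sequence n |-> n, whose transform at k <> 0 is
   N / (w ^ k - 1). The summand at k = 0 is 0 ^- 2 = 0. *)
Lemma sum_norm_prim_root_subr1 (F : numClosedFieldType) (N : nat) (w : F) :
  N.-primitive_root w ->
  \sum_(k < N) `|w ^+ k - 1| ^- 2 = (N%:R ^+ 2 - 1) / 12.
Proof.
move=> w_prim; have N_gt0 := prim_order_gt0 w_prim.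
have N_neq0 : N%:R != 0 :> F by rewrite pnatr_eq0 -lt0n.
pose k0 := Ordinal N_gt0.
pose S : F := \sum_(n < N) n%:R.
have parseval : \sum_(k < N) (\sum_(n < N) n%:R * (w ^+ k) ^+ n) *
    (\sum_(m < N) m%:R * ((w ^+ k)^-1) ^+ m) = N%:R * \sum_(n < N) n%:R ^+ 2.
  under eq_bigr do rewrite big_distrlr /=.
  rewrite exchange_big mulr_sumr; apply: eq_bigr => n _ /=.
  have kernel (m : 'I_N) : \sum_(k < N) n%:R * (w ^+ k) ^+ n *
      (m%:R * ((w ^+ k)^-1) ^+ m) = n%:R * m%:R * ((n == m)%:R * N%:R).
    rewrite -(sum_prim_root_orthogonal _ _ _ w_prim) mulr_sumr.
    by apply: eq_bigr => k _; rewrite exprVn -!exprM; ring.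
  rewrite exchange_big (eq_bigr _ (fun m _ => kernel m)) (bigD1 n) //= eqxx.
  rewrite [X in _ + X]big1 ?addr0 => [|m /negbTE]; first by rewrite mul1r; ring.
  by rewrite eq_sym => ->; rewrite mul0r mulr0.
(* At [k0] both transforms equal [S], while the first summand vanishes because the inverse of 0 is
   0; hence the correction [S ^+ 2]. *)
have term (k : 'I_N) : (\sum_(n < N) n%:R * (w ^+ k) ^+ n) *
    (\sum_(m < N) m%:R * ((w ^+ k)^-1) ^+ m) =
    N%:R ^+ 2 * `|w ^+ k - 1| ^- 2 + (k == k0)%:R * S ^+ 2.
  have [->|k_neq0] := eqVneq k k0.
    rewrite /= expr0 subrr normr0 expr0n invr0 mulr0 add0r mul1r invr1 expr2.
    by rewrite /S; congr (_ * _); apply: eq_bigr => i _; rewrite expr1n mulr1.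
  have zN : (w ^+ k) ^+ N = 1.
    by rewrite -exprM mulnC exprM (prim_expr_order w_prim) expr1n.
  have z_neq1 : w ^+ k != 1.
    rewrite -(prim_order_dvd w_prim) gtnNdvd // lt0n.
    by apply: contraNneq k_neq0 => k_eq0; apply/eqP/val_inj.
  (* On the unit circle inversion is conjugation, so the denominators [z - 1] and [z^-1 - 1] of the
     two transforms are conjugate and multiply to a squared modulus. *)
  have zC : Num.conj (w ^+ k) = (w ^+ k)^-1.
    rewrite invC_norm normrX (norm_prim_root _ _ _ w_prim).
    by rewrite !expr1n invr1 mul1r.
  have zV1 : (w ^+ k)^-1 != 1 by rewrite invr_eq1.
  rewrite mul0r addr0 !sum_natr_expr ?exprVn ?zN ?invr1 //.
  by rewrite normCK rmorphB rmorph1 /= zC invfM; ring.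
move: parseval; under eq_bigr do rewrite term.
rewrite big_split /= -mulr_sumr (bigD1 k0 (F := fun k => _ * S ^+ 2)) //=.
rewrite mul1r [X in _ + (_ + X)]big1 ?addr0 => [|k /negbTE->].
  2: by rewrite mul0r.
(* Dividing by [N ^ 2] leaves [(N - 1) (2 N - 1) / 6 - (N - 1) ^ 2 / 4], which is
   [(N ^ 2 - 1) / 12]. *)
rewrite /S sum_natr sum_natr_sqr => /eqP; rewrite -subr_eq0 => /eqP E.
apply: (mulfI (expf_neq0 2 N_neq0)); apply/eqP; rewrite -subr_eq0 -[eqbRHS]E.
by apply/eqP; field.
Qed.

(** * Fourier inversion on the grid and periodicity *)

Lemma discrete_fourier_inversion (F : fieldType) (d N : nat) (w : F)
    (w_prim : N.-primitive_root w) (f : grid d N -> F) (n : grid d N) :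
  \sum_(k : grid d N) (\sum_(m : grid d N) f m * \prod_j w ^- (k j * m j)) *
      \prod_j w ^+ (k j * n j) =
  N%:R ^+ d * f n.
Proof.
under eq_bigr do rewrite mulr_suml.
rewrite exchange_big /=.
have kernel (m : grid d N) :
    \sum_(k : grid d N) f m * \prod_j w ^- (k j * m j) *
      \prod_j w ^+ (k j * n j) = f m * ((n == m)%:R * N%:R ^+ d).
  under eq_bigr do rewrite -mulrA -big_split /=.
  rewrite -mulr_sumr; congr (_ * _).
  (* The sum over the grid factors into one-dimensional sums, each given by orthogonality. *)
  rewrite -(bigA_distr_bigA (fun j (k : 'I_N) =>
    w ^- (k * m j) * w ^+ (k * n j))) /=.
  rewrite (eq_bigr (fun j => (n j == m j)%:R * N%:R)) => [|j _]; last first.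
    rewrite -(sum_prim_root_orthogonal _ _ _ w_prim).
    by apply: eq_bigr => k _; rewrite mulrC.
  rewrite big_split /= prodr_const card_ord; congr (_ * _).
  have [n_eq_m|n_neq_m] := eqVneq n m.
    by apply: big1 => j _; rewrite n_eq_m eqxx.
  have /existsP[j n_neq_m_j] : [exists j, n j != m j].
    rewrite -negb_forall; apply: contraNN n_neq_m => /forallP n_eq_m.
    by apply/eqP/ffunP => j; apply/eqP.
  by rewrite (bigD1 j) //= (negbTE n_neq_m_j) mul0r.
rewrite (eq_bigr _ (fun m _ => kernel m)) (bigD1 n) //= eqxx mul1r.
rewrite [X in _ + X]big1 ?addr0 1?mulrC // => m /negbTE.
by rewrite eq_sym => ->; rewrite mul0r mulr0.
Qed.

(** Allows the reduction modulo [N] in [periodic_ext] to be replaced by integer exponents, on which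
    shifts act multiplicatively. *)
Lemma expr_residue (F : fieldType) (N : nat) (N_gt0 : (0 < N)%N) (z : F)
    (n : int) : z ^+ N = 1 -> z ^+ residue N_gt0 n = z ^ n.
Proof.
move=> zN; have z_neq0 : z != 0.
  apply: contra_eq_neq zN => ->.
  by rewrite expr0n gtn_eqF // eq_sym oner_eq0.
rewrite {2}(divz_eq n N) expfzDr // [(_ %/ _)%Z * _]mulrC -exprz_exp -exprnP zN.
rewrite exp1rz mul1r -[in RHS](gez0_abs (modz_ge0 n _)) // -?exprnP //.
by rewrite eqz_nat -lt0n.
Qed.

(** * Difference operators as Fourier multipliers *)

Section FourierMultipliers.

Variables (R : realType) (d : nat) (K : finType) (u : K -> 'I_d -> R[i]).
Hypothesis u_neq0 : forall k j, u k j != 0.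

(** The modes are kept abstract: [u k j] is the factor that mode [k] gains under a unit shift in
    direction [j]. Negative exponents are why [u] has to be nonzero. *)
Definition fourier_sum (a : K -> R[i]) (n : 'rV[int]_d) : R[i] :=
  \sum_k a k * \prod_j u k j ^ n 0 j.

Lemma fwd_diff_fourier_sum j g a :
  g =1 fourier_sum a ->
  fwd_diff j g =1 fourier_sum (fun k => (u k j - 1) * a k).
Proof.
move=> gE n; rewrite /fwd_diff !gE /fourier_sum -sumrB.
apply: eq_bigr => k _.
have -> : \prod_i u k i ^ (n + delta_mx 0 j) 0 i =
    u k j * \prod_i u k i ^ n 0 i.
  rewrite (bigD1 j) // [in RHS](bigD1 j) //= !mxE !eqxx /= expfzDr // expr1z.
  rewrite mulrA [_ * u k j]mulrC; congr (_ * _).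
  by apply: eq_bigr => i /negbTE i_neq_j; rewrite !mxE i_neq_j addr0.
ring.
Qed.

Lemma div_diff_fourier_sum N m j g a :
  g =1 fourier_sum a ->
  div_diff N m j g =1
    fourier_sum (fun k => (mesh R N ^- m)%:C * (u k j - 1) ^+ m * a k).
Proof.
move=> gE n; rewrite /div_diff.
have -> : iter m (fwd_diff j) g n =
    fourier_sum (fun k => (u k j - 1) ^+ m * a k) n.
  elim: m n => [|m IH] n.
    by rewrite /= gE; apply: eq_bigr => k _; rewrite expr0 mul1r.
  rewrite /= (fwd_diff_fourier_sum _ _ _ IH).
  by apply: eq_bigr => k _; rewrite exprS mulrA.
by rewrite /fourier_sum mulr_sumr; apply: eq_bigr => k _; rewrite !mulrA.
Qed.

Lemma mixed_div_diff_fourier_sum N m g a :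
  g =1 fourier_sum a ->
  mixed_div_diff N m g =1
    fourier_sum (fun k =>
      (\prod_j ((mesh R N ^- m)%:C * (u k j - 1) ^+ m)) * a k).
Proof.
move=> gE n; rewrite /mixed_div_diff.
(* As a product over the list [enum 'I_d], the multiplier can be built up along the same fold as the
   operator. *)
under [RHS]eq_bigr do rewrite -big_enum /=.
elim: (enum 'I_d) n => [|j s IH] n /=.
  by rewrite gE; apply: eq_bigr => k _; rewrite big_nil mul1r.
rewrite (div_diff_fourier_sum _ _ _ _ _ IH).
by apply: eq_bigr => k _; rewrite big_cons !mulrA.
Qed.

Lemma norm_fourier_sum_le a n :
  (forall k j, `|u k j| = 1) -> `|fourier_sum a n| <= \sum_k `|a k|.
Proof.
move=> u1; apply: le_trans (ler_norm_sum _ _ _) _; apply: ler_sum => k _.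
rewrite normrM normr_prod big1 ?mulr1 // => j _.
case: (n 0 j) => m; rewrite ?NegzE -?exprnN -?exprnP ?normfV normrX u1 //;
  by rewrite expr1n ?invr1.
Qed.

End FourierMultipliers.

Arguments fourier_sum {R d K}.

(** * The primitive root [expi (mesh R N)] *)

Lemma expiD (R : realType) (s t : R) : expi (s + t) = expi s * expi t.
Proof. by rewrite /expi cosD sinD; simpc; rewrite [X in _ +i* X]addrC. Qed.

Lemma expi0 (R : realType) : expi 0 = 1 :> R[i].
Proof. by rewrite /expi cos0 sin0. Qed.

Lemma expiN (R : realType) (t : R) : expi (- t) = (expi t)^-1.
Proof.
have E : expi (- t) * expi t = 1 by rewrite -expiD addNr expi0.
have e_neq0 : expi t != 0.
  by apply: contra_eq_neq E => ->; rewrite mulr0 eq_sym oner_eq0.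
by apply: (mulIf e_neq0); rewrite E mulVf.
Qed.

Lemma expi_mulrn (R : realType) (t : R) (n : nat) :
  expi (t * n%:R) = expi t ^+ n.
Proof.
elim: n => [|n IH]; first by rewrite mulr0 expi0.
by rewrite -natr1 mulrDr mulr1 expiD IH exprSr.
Qed.

(** By [cos t = 1 - 2 sin (t / 2) ^ 2], equality would force [sin (t / 2) = 0], whereas [t / 2] lies
    strictly between 0 and [pi]. *)
Lemma expi_neq1 (R : realType) (t : R) :
  0 < t < 2 * pi -> expi t != 1.
Proof.
move=> /andP[t_gt0 t_lt].
have sin_gt0 : 0 < sin (t / 2) by apply: sin_gt0_pi; apply/andP; split; lra.
apply/negP => /eqP/(congr1 (@complex.Re R)) /= cost.
have : cos (t / 2 *+ 2) = 1 by rewrite -mulr_natr divfK ?pnatr_eq0.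
rewrite cos_mulr2n cos2sin2 => E.
have : sin (t / 2) ^+ 2 = 0 by lra.
by apply/eqP; rewrite expf_neq0 // gt_eqF.
Qed.

Lemma expi_prim_root (R : realType) (N : nat) :
  (0 < N)%N -> N.-primitive_root (expi (mesh R N) : R[i]).
Proof.
move=> N_gt0; have N_pos : 0 < N%:R :> R by rewrite ltr0n.
have wN : expi (mesh R N) ^+ N = 1.
  by rewrite -expi_mulrn /mesh divfK ?gt_eqF // /expi mulr_natl cos2pi sin2pi.
apply/andP; split=> //; apply/forallP => i; rewrite unity_rootE.
have [iN|i_neq] := eqVneq i.+1 N; first by rewrite iN wN eqxx.
rewrite eqbF_neg -expi_mulrn expi_neq1 // /mesh.
have i_lt : i.+1%:R < N%:R :> R by rewrite ltr_nat ltn_neqAle i_neq ltn_ord.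
have pi2 : 0 < 2 * pi :> R by rewrite mulr_gt0 ?pi_gt0.
apply/andP; split; first by rewrite mulr_gt0 ?divr_gt0 ?ltr0n.
by rewrite mulrAC ltr_pdivrMr // ltr_pM2l.
Qed.

(** * The Fourier sum of the data and bounds on its terms *)

Lemma dftE (R : realType) (d N : nat) (f : grid d N -> R[i]) (k : grid d N) :
  dft f k = \sum_(m : grid d N) f m * \prod_j expi (mesh R N) ^- (k j * m j).
Proof.
apply: eq_bigr => m _; congr (_ * _).
by rewrite expiN expi_mulrn prodfV prodrXr.
Qed.

Lemma periodic_ext_fourier_sum (R : realType) (d N : nat) (N_gt0 : (0 < N)%N)
    (f : grid d N -> R[i]) :
  periodic_ext N_gt0 f =1
    fourier_sum (fun (k : grid d N) j => expi (mesh R N) ^+ k j)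
      (fun k => N%:R ^- d * dft f k).
Proof.
move=> n; have w_prim := expi_prim_root R N N_gt0.
have Nd_neq0 : N%:R ^+ d != 0 :> R[i].
  by rewrite expf_neq0 // pnatr_eq0 -lt0n.
apply: (mulfI Nd_neq0); rewrite /periodic_ext.
rewrite -(discrete_fourier_inversion _ _ _ _ w_prim) mulr_sumr.
apply: eq_bigr => k _; rewrite -dftE mulrA mulVKf //; congr (_ * _).
apply: eq_bigr => j _; rewrite ffunE exprM expr_residue //.
by rewrite -exprM mulnC exprM (prim_expr_order w_prim) expr1n.
Qed.

(** Carries the decay hypothesis from the real-valued modulus to the norm with values in [R[i]], in
    which the algebraic lemmas are stated. *)
Lemma normC_le_prod (R : rcfType) (I : finType) (z : R[i]) (b : R)
    (y : I -> R[i]) (M : nat) :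
  Normc.normc z <= b * \prod_j Normc.normc (y j) ^- M ->
  `|z| <= b%:C * \prod_j `|y j| ^- M.
Proof.
have normE (x : R[i]) : `|x| = (Normc.normc x)%:C by [].
rewrite -lecR normE rmorphM rmorph_prod => /le_trans; apply.
rewrite le_eqVlt; apply/predU1P; left; congr (_ * _).
by apply: eq_bigr => j _; rewrite normE fmorphV rmorphXn.
Qed.

(** The decay hypothesis has the opposite sign in the exponent to the difference multiplier;
    [v^-1 - 1 = v^-1 * (1 - v)] with [|v| = 1] reconciles them. *)
Lemma norm_expi_subr1 (R : realType) (N k : nat) : (0 < N)%N ->
  `|expi (- (2 * pi * k%:R / N%:R)) - 1 : R[i]| =
  `|expi (mesh R N) ^+ k - 1|.
Proof.
move=> N_gt0; have := norm_prim_root _ _ _ (expi_prim_root R N N_gt0).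
rewrite mulrAC expiN expi_mulrn -/(mesh R N).
set v := _ ^+ k => w1; have v1 : `|v| = 1 by rewrite normrX w1 expr1n.
have v_neq0 : v != 0 by rewrite -normr_eq0 v1 oner_eq0.
have -> : v^-1 - 1 = v^-1 * (1 - v) by rewrite mulrBr mulr1 mulVf.
by rewrite normrM normfV v1 invr1 mul1r distrC.
Qed.

(** Here [m + 2] stands for [M]. If some [k j = 0], the multiplier contains [0 ^ m = 0]. Otherwise,
    in each direction, [m] of the [m + 2] powers of [h] and of the modulus cancel against the
    multiplier. *)
Lemma norm_coef_le (F : numFieldType) (d N m : nat) (w c h C : F)
    (k : grid d N) (w_prim : N.-primitive_root w) :
  (0 < m)%N -> 0 < h -> 0 <= C ->
  ((forall j, (k j : nat) <> 0%N) ->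
    `|c| <= N%:R ^+ d * h ^+ ((m + 2) * d) * C *
            \prod_j `|w ^+ k j - 1| ^- (m + 2)) ->
  `|\prod_j (h ^- m * (w ^+ k j - 1) ^+ m) * (N%:R ^- d * c)| <=
    C * \prod_j (h ^+ 2 * `|w ^+ k j - 1| ^- 2).
Proof.
move=> m_gt0 h_gt0 C_ge0 c_le; have h_neq0 : h != 0 by rewrite gt_eqF.
have [/existsP[j /eqP kj0]|] := boolP [exists j, (k j : nat) == 0%N].
  rewrite (bigD1 j) //= kj0 expr0 subrr expr0n gtn_eqF // mulr0 !mul0r normr0.
  by rewrite mulr_ge0 // prodr_ge0 // => i _; rewrite mulr_ge0 ?exprn_ge0
    ?invr_ge0 ?exprn_ge0 // ltW.
rewrite negb_exists => /forallP k_neq0.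
have {}c_le := c_le (fun j => elimN eqP (k_neq0 j)).
have N_gt0 : 0 < N%:R :> F by rewrite ltr0n (prim_order_gt0 w_prim).
have v_neq1 j : `|w ^+ k j - 1| != 0.
  by rewrite normr_eq0 subr_eq0 -(prim_order_dvd w_prim) gtnNdvd ?lt0n.
rewrite !normrM normfV normrX [`|N%:R|]gtr0_norm // mulrA.
apply: le_trans (ler_wpM2l _ c_le) _.
  by rewrite mulr_ge0 ?invr_ge0 ?exprn_ge0 // ltW.
rewrite normr_prod exprM le_eqVlt; apply/orP; left; apply/eqP.
have -> : h ^+ (m + 2) ^+ d = \prod_(j < d) h ^+ (m + 2).
  by rewrite prodr_const card_ord.
rewrite [RHS](_ : _ = C * \prod_j (`|h ^- m * (w ^+ k j - 1) ^+ m| *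
  (h ^+ (m + 2) * `|w ^+ k j - 1| ^- (m + 2)))).
  rewrite !big_split /=; field.
  by rewrite gt_eqF // exprn_gt0.
congr (_ * _); apply: eq_bigr => j _.
rewrite normrM normfV !normrX (gtr0_norm h_gt0) !exprD; field.
by rewrite !expf_neq0 ?h_neq0 ?v_neq1.
Qed.

Theorem theorem2p3 (R : realType) (d N M : nat)
    (d_ge1 : (1 <= d)%N) (N_ge2 : (2 <= N)%N) (M_ge3 : (3 <= M)%N)
    (f : grid d N -> R[i]) (C : R) (C_gt0 : 0 < C)
    (decay : forall k : grid d N, (forall j : 'I_d, (k j : nat) <> 0%N) ->
       Normc.normc (dft f k) <=
         N%:R ^+ d * (2 * pi / N%:R) ^+ (M * d) * C *
         \prod_(j < d)
           Normc.normc (expi (- (2 * pi * (k j)%:R / N%:R)) - 1 : R[i]) ^- M) :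
  grid_norm N (mixed_div_diff N (M - 2) (periodic_ext (ltnW N_ge2) f)) <=
    (pi ^+ 2 / 3) ^+ d * (1 - 1 / N%:R ^+ 2) ^+ d * C.
Proof.
set N_gt0 := ltnW N_ge2; have w_prim := expi_prim_root R N N_gt0.
have h_gt0 : 0 < mesh R N by rewrite divr_gt0 ?mulr_gt0 ?pi_gt0 ?ltr0n.
have N2_ge1 : 1 <= N%:R ^+ 2 :> R by rewrite exprn_ege1 // ler1n.
(* Bounding the iterated maximum also requires bounding its default value 0. *)
have rhs_ge0 : 0 <= (pi ^+ 2 / 3) ^+ d * (1 - 1 / N%:R ^+ 2) ^+ d * C.
  rewrite !mulr_ge0 ?exprn_ge0 ?divr_ge0 ?sqr_ge0 ?(ltW C_gt0) //.
  by rewrite subr_ge0 div1r invf_le1 // (lt_le_trans ltr01).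
apply: bigmax_le => // p _; rewrite -lecR.
rewrite -[leLHS]/`|mixed_div_diff _ _ _ _|.
have w_neq0 (k : grid d N) j : expi (mesh R N) ^+ k j != 0.
  by rewrite expf_neq0 // (prim_root_eq0 w_prim) -lt0n.
rewrite (mixed_div_diff_fourier_sum _ _ _ _ w_neq0 _ _ _ _
  (periodic_ext_fourier_sum R d N N_gt0 f)).
apply: le_trans (norm_fourier_sum_le _ _ _ _ _ _ _) _ => [k j|].
  by rewrite normrX (norm_prim_root _ _ _ w_prim) expr1n.
(* The majorant may run over the whole grid: when some [k j = 0], its term is 0, because the inverse
   of 0 is 0. *)
apply: (@le_trans _ _ (\sum_(k : grid d N) C%:C * \prod_j
    ((mesh R N)%:C ^+ 2 * `|expi (mesh R N) ^+ k j - 1| ^- 2))).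
  apply: ler_sum => k _; under eq_bigr do rewrite fmorphV rmorphXn /=.
  apply: (norm_coef_le _ _ _ _ _ _ _ _ _ w_prim); rewrite ?subn_gt0 ?ltcR //.
    by rewrite lecR ltW.
  move=> k_neq0; rewrite subnK; last exact: ltnW.
  have /normC_le_prod := decay k k_neq0.
  under eq_bigr do rewrite norm_expi_subr1 //.
  suff -> : (N%:R ^+ d * (2 * pi / N%:R) ^+ (M * d) * C)%:C =
      N%:R ^+ d * (mesh R N)%:C ^+ (M * d) * C%:C by [].
  by rewrite -(rmorph_nat (real_complex R)) -!rmorphXn -!rmorphM.
rewrite -mulr_sumr -(bigA_distr_bigA (fun j (k : 'I_N) =>
  (mesh R N)%:C ^+ 2 * `|expi (mesh R N) ^+ k - 1| ^- 2)) /=.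
rewrite prodr_const card_ord -mulr_sumr (sum_norm_prim_root_subr1 _ _ _ w_prim).
(* With [h = 2 pi / N], the factor [h ^ 2 N ^ 2 / 12] is [pi ^ 2 / 3]. *)
have -> : (mesh R N)%:C ^+ 2 * ((N%:R ^+ 2 - 1) / 12) =
    ((pi ^+ 2 / 3) * (1 - 1 / N%:R ^+ 2))%:C.
  have -> : (pi ^+ 2 / 3) * (1 - 1 / N%:R ^+ 2) =
      mesh R N ^+ 2 * ((N%:R ^+ 2 - 1) / 12) :> R.
    by rewrite /mesh; field; rewrite pnatr_eq0 -lt0n.
  rewrite [RHS]rmorphM rmorphXn; congr (_ * _).
  rewrite fmorph_div rmorphB rmorphXn.
  by rewrite !rmorph_nat rmorph1.
by rewrite -rmorphXn -rmorphM lecR mulrC exprMn.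
Qed.
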